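(* Let $S$ be a monoidal Shannon extension of a regular local ring $R$. If $S$ is Noetherian, then $S$ is a regular local ring of dimension at most $\dim R-1$.
   Context: Let $(R,\mathfrak{m})$ be a regular local ring. A prime ideal $\mathfrak{p}$ of $R$ is a regular prime if $R/\mathfrak{p}$ is a regular local ring. If $\mathfrak{p}$ is a regular prime of $R$ with $\mathrm{ht}\,\mathfrak{p}\ge 2$, $x\in\mathfrak{p}\setminus\mathfrak{p}^2$, and $\mathfrak{m}_1$ is a maximal ideal of $R[\mathfrak{p}/x]$ with $\mathfrak{m}_1\cap R=\mathfrak{m}$, then $R_1=R[\mathfrak{p}/x]_{\mathfrak{m}_1}$ is called a local monoidal transform of $R$ (it is again a regular local ring). A monoidal Shannon extension of $R$ is a ring $S=\bigcup_{n\ge 0}R_n$ where $R_0=R$, $\{(R_n,\mathfrak{m}_n)\}_{n\ge 0}$ is an infinite sequence in which each $R_{n+1}=R_n[\mathfrak{p}_n/x_n]_{\mathfrak{m}_{n+1}}$ is a local monoidal transform of $R_n$ (with $\mathfrak{p}_n$ a regular prime of $R_n$ of height at least $2$, $x_n\in\mathfrak{p}_n\setminus\mathfrak{p}_n^2$, $\mathfrak{m}_n\subseteq\mathfrak{m}_{n+1}$), and all $R_n$ have the same dimension $d=\dim R\ge 2$. $S$ is a local domain with maximal ideal $\mathfrak{m}_S=\bigcup_n\mathfrak{m}_n$. Local rings are not assumed Noetherian. *)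

(* Defs.v *)
From HB Require Import structures.
From mathcomp Require Import all_boot all_order all_algebra.
From mathcomp Require Import ring_quotient.
From mathcomp Require Import boolp classical_sets.

Set Implicit Arguments.
Unset Strict Implicit.
Unset Printing Implicit Defensive.

Import GRing.Theory.
Local Open Scope ring_scope.

(* The library structures [idealr A] and [prime_idealr A] consist of PROPER
   ideals, given by boolean predicates; under the axioms of boolp every proper
   ideal is of this form.  Such ideals are compared extensionally, by [=i]. *)

Section CommutativeRings.
Variable A : comNzRingType.

Definition generated_by (I : {pred A}) (n : nat) : Prop :=
  exists g : 'I_n -> A,
    forall a, a \in I <-> exists c : 'I_n -> A, a = \sum_(i < n) c i * g i.

(* Only proper ideals are considered: the unit ideal is generated by 1. *)
Definition noetherian : Prop := forall I : idealr A, exists n, generated_by I n.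

Definition maximal_ideal (m : idealr A) : Prop :=
  forall I : idealr A, {subset m <= I} -> I =i m.

Definition local_with (m : idealr A) : Prop :=
  maximal_ideal m /\ forall m' : idealr A, maximal_ideal m' -> m' =i m.

Definition strict_subset (I J : {pred A}) : Prop :=
  {subset I <= J} /\ ~ {subset J <= I}.

(* P_0 < P_1 < ... < P_n, a chain of length n *)
Definition prime_chain (n : nat) (P : 'I_n.+1 -> prime_idealr A) : Prop :=
  forall i j : 'I_n.+1, (i < j)%N -> strict_subset (P i) (P j).

Definition krull_dim_ge (n : nat) : Prop :=
  exists P : 'I_n.+1 -> prime_idealr A, prime_chain P.

(* Chains can be truncated, so this says that the supremum of the lengths is d. *)
Definition krull_dim (d : nat) : Prop := krull_dim_ge d /\ ~ krull_dim_ge d.+1.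

Definition height_ge (p : prime_idealr A) (n : nat) : Prop :=
  exists2 P : 'I_n.+1 -> prime_idealr A, prime_chain P & P ord_max =i p.

Definition ideal_mul (I J : {pred A}) : set A :=
  [set z | exists n (a b : 'I_n -> A),
    [/\ forall i, a i \in I, forall i, b i \in J
      & z = \sum_(i < n) a i * b i]].

Definition regular_local : Prop :=
  noetherian /\
  exists2 m : idealr A, local_with m &
    exists2 d : nat, krull_dim d & generated_by m d.

End CommutativeRings.

Definition regular_prime (A : comNzRingType) (p : prime_idealr A) : Prop :=
  regular_local {ideal_quot p}.

(* A regular local ring and its monoidal transforms are domains with a common
   fraction field; they are taken as subrings of a field K containing it. *)
Section Subrings.
Variable K : fieldType.

Definition subring (R : subringClosed K) : Type := {x : K | x \in R}.

HB.instance Definition _ (R : subringClosed K) := SubChoice.on (subring R).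
HB.instance Definition _ (R : subringClosed K) :=
  [SubChoice_isSubComNzRing of subring R by <:].

(* R[X], as the smallest subring of K containing R and X *)
Definition adjoin (R : subringClosed K) (X : set K) : {pred K} :=
  fun z => `[< forall T : subringClosed K,
                 {subset R <= T} -> (forall t, X t -> t \in T) -> z \in T >].

Lemma adjoin_subring_closed R X : subring_closed (adjoin R X).
Proof.
split=> [|u v /asboolP uT /asboolP vT|u v /asboolP uT /asboolP vT];
  apply/asboolP => T RT XT; first exact: rpred1.
- by rewrite rpredB ?uT ?vT.
- by rewrite rpredM ?uT ?vT.
Qed.

HB.instance Definition _ (R : subringClosed K) (X : set K) :=
  GRing.isSubringClosed.Build K (adjoin R X) (adjoin_subring_closed R X).

(* R[I/x] *)
Definition blowup_algebra (R : subringClosed K) (I : {pred subring R})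
    (x : subring R) : subringClosed K :=
  adjoin R [set z | exists2 y, y \in I & z = \val y / \val x].

(* The localization B_q, inside K; it is used for q maximal. *)
Definition localization (B : subringClosed K) (q : idealr (subring B)) : set K :=
  [set z | exists a b : subring B, b \notin q /\ z = \val a / \val b].

(* m <= m', for ideals m of R and m' of R', as subsets of K *)
Definition ideal_sub (R R' : subringClosed K)
    (m : {pred subring R}) (m' : {pred subring R'}) : Prop :=
  forall a, a \in m -> exists2 b, b \in m' & \val b = \val a.

(* m' meets R (contained in R') in m *)
Definition lies_over (R R' : subringClosed K)
    (m : {pred subring R}) (m' : {pred subring R'}) : Prop :=
  forall z : K, (exists2 a, a \in m & \val a = z) <->
                (z \in R /\ exists2 b, b \in m' & \val b = z).

(* A local monoidal transform is only defined for a regular local ring R. *)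
Definition local_monoidal_transform (R R1 : subringClosed K) : Prop :=
  regular_local (subring R) /\
  exists (m : idealr (subring R)) (p : prime_idealr (subring R))
         (x : subring R) (m1 : idealr (subring (blowup_algebra p x))),
    [/\ local_with m,
        regular_prime p /\ height_ge p 2,
        x \in p /\ ~ ideal_mul p p x,
        maximal_ideal m1 /\ lies_over m m1 &
        forall z : K, z \in R1 <-> localization m1 z].

Definition monoidal_shannon_extension (R S : subringClosed K) : Prop :=
  exists2 R_ : nat -> subringClosed K,
    [/\ R_ 0%N =i R,
        forall n, local_monoidal_transform (R_ n) (R_ n.+1),
        forall n (m : idealr (subring (R_ n))) (m' : idealr (subring (R_ n.+1))),
          local_with m -> local_with m' -> ideal_sub m m' &
        exists2 d : nat, (2 <= d)%N & forall n, krull_dim (subring (R_ n)) d] &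
    forall z : K, z \in S <-> exists n, z \in R_ n.

End Subrings.

(* Main.v *)
Require Import Defs.
From HB Require Import structures.
From mathcomp Require Import all_boot all_order all_algebra.
From mathcomp Require Import ring_quotient ring.
From mathcomp Require Import boolp classical_sets.

(* Write S as the union of the R_n, with maximal ideals m_n.  Since the ideal
   p_n of R_n becomes principal in R_(n+1) and R_n/p_n has dimension at most
   d - 2, the ideal m_n S is generated by d - 1 elements; as m_S is finitely
   generated, m_S = m_n S for some n.  Let z_1, ..., z_e be a minimal system of
   generators of m_S.  By minimality the z_i are independent modulo m_n^2 for all
   large n, so they are part of a regular system of parameters of R_n and each
   (z_1, ..., z_i)R_n is prime.  Hence each (z_1, ..., z_i)S is prime, which gives
   dim S >= e, while dim S <= e by Krull's principal ideal theorem. *)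

Set Implicit Arguments.
Unset Strict Implicit.
Unset Printing Implicit Defensive.

Import GRing.Theory.
Local Open Scope classical_set_scope.
Local Open Scope ring_scope.

(** No single R_n determines the dimension of S, since S is neither a quotient nor a localization of
    one; the primes of the lower bound have to be assembled from all late stages at once.
    Independence passes from S down to R_n because a relation modulo m_n^2 becomes, in S, a relation
    (1 - c) z_i = combination of the other z_j with c in m_S, and 1 - c is a unit. Primality in R_n
    is a relative form of the argument that a regular local ring is a domain: an independent list
    extends to d generators of m_n, Krull's theorem routes a chain of length d through the first i
    of them, and Nakayama's lemma forces the bottom prime of the rerouted chain to be generated by
    these i elements. Krull's theorem and Nakayama's lemma are proved with ideals of the ring
    itself: contraction along elements outside P stands for localization at P, and a base prime or
    ideal is carried along in place of a quotient ring. *)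

Lemma seq_in_directed_union (T : eqType) (C : nat -> set T) (s : seq T) :
  (forall n, C n `<=` C n.+1) -> (forall x, x \in s -> exists n, C n x) ->
  exists N, forall n, (N <= n)%N -> forall x, x \in s -> C n x.
Proof.
move=> CS; have Cmono m n : (m <= n)%N -> C m `<=` C n.
  by move/subnKC<-; elim: (n - m)%N => [|k IH] x Cx; rewrite ?addn0 // addnS; apply/CS/IH.
elim: s => [|y s IH] sC; first by exists 0%N.
have [|N HN] := IH; first by move=> x xs; apply: sC; rewrite inE xs orbT.
have [|N' HN'] := sC y; first by rewrite inE eqxx.
exists (maxn N N') => n; rewrite geq_max => /andP[Nn N'n] x.
rewrite inE => /orP[/eqP->|]; first exact: (Cmono N').
exact: HN.
Qed.

(** * Ideals as sets: generation, local rings, saturation at a prime *)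

Section Ideals.
Variable A : comNzRingType.
Implicit Types (I J L P Q X : set A) (s : seq A).

(** The unit ideal is allowed, unlike in [idealr], so sums, colons and saturations carry no
    properness condition. *)
Definition is_ideal I :=
  [/\ I 0, forall a b, I a -> I b -> I (a + b) & forall r a, I a -> I (r * a)].

Definition is_prime P :=
  [/\ is_ideal P, ~ P 1 & forall a b, P (a * b) -> P a \/ P b].

Definition is_local m :=
  [/\ is_ideal m, ~ m 1 & forall a, ~ m a -> exists b, b * a = 1].

Definition gen X : set A :=
  [set z | forall J, is_ideal J -> X `<=` J -> J z].

(** The ideal I + Aa. Recording only the coefficient of a turns membership into a congruence modulo
    I. *)
Definition adj I a : set A := [set z | exists r, I (z - r * a)].

(* The contraction of the extension of I to the localization at P. *)
Definition saturation P I : set A := [set a | exists2 t, ~ P t & I (t * a)].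

Definition saturated P I := forall t a, ~ P t -> I (t * a) -> I a.

Definition noether := forall I, is_ideal I -> exists s, I = gen [set` s].

Lemma idealB I a b : is_ideal I -> I a -> I b -> I (a - b).
Proof. by case=> _ ID IM Ia Ib; apply: ID => //; rewrite -mulN1r; apply: IM. Qed.

Lemma gen_ideal X : is_ideal (gen X).
Proof.
split=> [J []//|a b Ga Gb J JI XJ|r a Ga J JI XJ]; have [_ JD JM] := JI.
  by apply: JD; [apply: Ga|apply: Gb].
by apply: JM; apply: Ga.
Qed.

Lemma sub_gen X : X `<=` gen X.
Proof. by move=> x Xx J _; apply. Qed.

Lemma gen_min X J : is_ideal J -> X `<=` J -> gen X `<=` J.
Proof. by move=> JI XJ z; apply. Qed.

Lemma gen_mono X Y : X `<=` Y -> gen X `<=` gen Y.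
Proof.
by move=> XY; apply: gen_min; [exact: gen_ideal|move=> x /XY; apply: sub_gen].
Qed.

Lemma adj_ideal I a : is_ideal I -> is_ideal (adj I a).
Proof.
case=> I0 ID IM; split; first by exists 0; rewrite mul0r subr0.
- move=> u v [r Iu] [q Iv]; exists (r + q).
  by have := ID _ _ Iu Iv; congr I; ring.
- by move=> t u [r Iu]; exists (t * r); have := IM t _ Iu; congr I; ring.
Qed.

Lemma sub_adj I a : I `<=` adj I a.
Proof. by move=> z Iz; exists 0; rewrite mul0r subr0. Qed.

Lemma adj_self I a : is_ideal I -> adj I a a.
Proof. by case=> I0 _ _; exists 1; rewrite mul1r subrr. Qed.

Lemma adj_min I J a : is_ideal J -> I `<=` J -> J a -> adj I a `<=` J.
Proof.
move=> [_ JD JM] IJ Ja z [r Iz]; rewrite -(subrK (r * a) z).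
by apply: JD; [apply: IJ|apply: JM].
Qed.

Lemma gen_adj X a : gen (a |` X) = adj (gen X) a.
Proof.
apply/seteqP; split.
  apply: gen_min; first exact/adj_ideal/gen_ideal.
  move=> z [->|Xz]; first exact/adj_self/gen_ideal.
  by apply: sub_adj; apply: sub_gen.
apply: adj_min; first exact: gen_ideal.
- by apply: gen_mono => z; right.
- by apply: sub_gen; left.
Qed.

Lemma set_mem_cons (T : eqType) (a : T) (s : seq T) : [set` a :: s] = a |` [set` s].
Proof.
apply/seteqP; split=> x /=; rewrite inE.
  by move=> /orP[/eqP->|]; [left|right].
by case=> [->|->]; rewrite ?eqxx ?orbT.
Qed.

Lemma gen_cons a s : gen [set` a :: s] = adj (gen [set` s]) a.
Proof. by rewrite set_mem_cons gen_adj. Qed.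

Lemma prime_exp P a n : is_prime P -> P (a ^+ n) -> P a.
Proof.
move=> [_ P1 PM]; elim: n => [|n IH]; first by rewrite expr0.
by rewrite exprS => /PM[].
Qed.

Lemma local_prime m : is_local m -> is_prime m.
Proof.
move=> [mI m1 mU]; split=> // a b mab.
have [ma|/mU[c ca]] := pselect (m a); [by left|right].
by rewrite -(mul1r b) -ca -mulrA; case: mI => _ _; apply.
Qed.

Lemma sub_local m I : is_local m -> is_ideal I -> ~ I 1 -> I `<=` m.
Proof.
move=> [mI m1 mU] II I1 a Ia; apply: contrapT => /mU[b ba]; apply: I1.
by rewrite -ba; case: II => _ _; apply.
Qed.

Lemma saturation_ideal P I : is_prime P -> is_ideal I -> is_ideal (saturation P I).
Proof.
move=> [_ P1 PM] [I0 ID IM]; split; first by exists 1; rewrite ?mulr0.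
- move=> a b [t Pt Ia] [u Pu Ib]; exists (t * u); first by case/PM.
  by have := ID _ _ (IM u _ Ia) (IM t _ Ib); congr I; ring.
- by move=> r a [t Pt Ia]; exists t => //; rewrite mulrCA; apply: IM.
Qed.

Lemma saturation_saturated P I : is_prime P -> saturated P (saturation P I).
Proof.
move=> [_ P1 PM] t a Pt [u Pu Ia]; exists (u * t); first by case/PM.
by rewrite -mulrA.
Qed.

Lemma sub_saturation P I : is_prime P -> I `<=` saturation P I.
Proof. by case=> _ P1 _ a Ia; exists 1; rewrite ?mul1r. Qed.

Lemma saturation_mono P I J : I `<=` J -> saturation P I `<=` saturation P J.
Proof. by move=> IJ a [t Pt /IJ]; exists t. Qed.

(** * Noetherian induction and Krull's principal ideal theorem *)

Lemma noether_max (F : set (set A)) : noether ->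
  (forall I, F I -> is_ideal I) -> (exists I, F I) ->
  exists2 I, F I & forall J, F J -> I `<=` J -> J `<=` I.
Proof.
move=> nA FI [I0 FI0]; apply: contrapT => nomax.
(* Without a maximal member, choice yields a strictly increasing sequence in F. Its union is
   finitely generated, so some [C N] contains the generators and the sequence stops there. *)
have /choice[f fP] : forall I, exists J, F I -> [/\ F J, I `<=` J & ~ J `<=` I].
  move=> I; apply: contrapT => nJ; apply: nomax; exists I.
    by apply: contrapT => nFI; apply: nJ; exists I.
  move=> J FJ IJ; apply: contrapT => JI; apply: nJ; exists J => _; split=> //.
pose C n := iter n f I0.
have FC n : F (C n) by elim: n => //= n /fP[].
have CS n : C n `<=` C n.+1 by have [] := fP _ (FC n).
have CI n : is_ideal (C n) by apply: FI.
have UI : is_ideal [set a | exists n, C n a].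
  split=> [|a b [n Ca] [k Cb]|r a [n Ca]].
  - by exists 0%N; have [] := CI 0%N.
  - have [|N /(_ N (leqnn N)) CN] := @seq_in_directed_union A C [:: a; b] CS.
      by move=> x; rewrite !inE => /orP[]/eqP->; [exists n|exists k].
    exists N; have [_ CD _] := CI N.
    by apply: CD; apply: CN; rewrite !inE eqxx ?orbT.
  - by exists n; have [_ _] := CI n; apply.
have [s Us] := nA _ UI.
have [x xs|N /(_ N (leqnn N)) CN] := @seq_in_directed_union A C s CS.
  have: gen [set` s] x by apply: sub_gen.
  by rewrite -Us.
have [_ _ []] := fP _ (FC N); move=> x fx.
have: gen [set` s] x by rewrite -Us; exists N.+1.
exact: gen_min.
Qed.

(* This replaces the fact that the localization of A at a prime P minimal over
   I is Artinian modulo I: an ideal maximal among those for which the claim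
   fails is prime. *)
Lemma saturated_dcc P I (C : nat -> set A) : noether -> is_prime P ->
  is_ideal I ->
  (forall Q, is_prime Q -> I `<=` Q -> Q `<=` P -> P `<=` Q) ->
  (forall n, [/\ is_ideal (C n), saturated P (C n) & I `<=` C n]) ->
  (forall n, C n.+1 `<=` C n) ->
  exists N, forall n, (N <= n)%N -> C n `<=` C n.+1.
Proof.
move=> nA prP idI minP; move: C.
pose good J := forall C : nat -> set A,
  (forall n, [/\ is_ideal (C n), saturated P (C n) & J `<=` C n]) ->
  (forall n, C n.+1 `<=` C n) ->
  exists N, forall n, (N <= n)%N -> C n `<=` C n.+1.
suff: good I by [].
apply: contrapT => badI.
have [||J [idJ IJ badJ] maxJ] :=
    @noether_max [set J | [/\ is_ideal J, I `<=` J & ~ good J]] nA.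
- by move=> J [].
- by exists I; split.
have goodJ L : is_ideal L -> J `<=` L -> ~ (L `<=` J) -> good L.
  move=> idL JL LJ; apply: contrapT => badL; apply: LJ; apply: maxJ => //.
  by split=> //; apply: subset_trans JL.
have [PI P1 PM] := prP.
(* An element of J outside P would make every saturated [C n] the unit ideal, and J would be
   good. *)
have JP : J `<=` P.
  move=> t Jt; apply: contrapT => Pt; apply: badJ => C CP _.
  exists 0%N => n _ a _; have [[_ _ CM] Csat JC] := CP n.+1.
  by apply: (Csat t) => //; rewrite mulrC; apply/CM/JC.
have prJ : is_prime J.
  split=> [//|/JP//|a b Jab]; apply: contrapT => nJ.
  have Ja : ~ J a by move=> Ja; apply: nJ; left.
  have Jb : ~ J b by move=> Jb; apply: nJ; right.
  have [J0 JD JM] := idJ.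
  apply: badJ => C CP CS.
  (* As in the exact sequence relating A/(C : a), A/C and A/(C + (a)), stability of [C n] follows
     from that of its sum with (a) and of its colon by a. These contain J + (a) and J : a, both
     strictly larger than J, hence good. *)
  have nJa : ~ (adj J a `<=` J) by move=> /(_ a (adj_self _ idJ)).
  have [||N1 HN1] := goodJ _ (adj_ideal a idJ) (@sub_adj J a) nJa
    (fun n => saturation P (adj (C n) a)).
  - move=> n; have [CI Csat JC] := CP n; split.
    + exact/saturation_ideal/adj_ideal.
    + exact: saturation_saturated.
    + move=> z [r Jz]; apply: sub_saturation => //; exists r; exact: JC.
  - by move=> n; apply: saturation_mono => z [r Cz]; exists r; apply: CS.
  have colonI L : is_ideal L -> is_ideal [set r | L (r * a)].
    move=> [L0 LD LM]; split=> [|u v Lu Lv|r u Lu] /=.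
    + by rewrite mul0r.
    + by rewrite mulrDl; apply: LD.
    + by rewrite -mulrA; apply: LM.
  have Jcolon : J `<=` [set r | J (r * a)].
    by move=> r Jr /=; rewrite mulrC; apply: JM.
  have nJcolon : ~ ([set r | J (r * a)] `<=` J).
    by move=> /(_ b) /=; rewrite mulrC => /(_ Jab).
  have [||N2 HN2] := goodJ _ (colonI _ idJ) Jcolon nJcolon
    (fun n => [set r | C n (r * a)]).
  - move=> n; have [CI Csat JC] := CP n; split; first exact: colonI.
    + by move=> t r Pt /=; rewrite -mulrA; apply: Csat.
    + by move=> r /JC.
  - by move=> n r /CS.
  exists (maxn N1 N2) => n; rewrite geq_max => /andP[le1 le2] c Cc.
  have [CI Csat JC] := CP n; have [CI' Csat' JC'] := CP n.+1.
  have [t Pt [r Cr]] : saturation P (adj (C n.+1) a) c.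
    by apply: HN1 => //; apply: sub_saturation => //; apply: sub_adj.
  apply: (Csat' t) => //; rewrite -(subrK (r * a) (t * c)).
  have [_ CD' _] := CI'; apply: CD' => //; apply: HN2 => //=.
  have -> : r * a = t * c - (t * c - r * a) by ring.
  by apply: idealB => //; [case: CI => _ _; apply|apply: CS].
(* Thus J = P. Either some [C N] lies in P, and the sequence equals P from there on, or every [C n]
   meets the complement of P and, being saturated, is the unit ideal. *)
have PJ := minP _ prJ IJ JP.
apply: badJ => C CP CS.
have [[N CN]|nC] := pselect (exists N, C N `<=` P).
  have Cmono n : (N <= n)%N -> C n `<=` P.
    move/subnKC<-; elim: (n - N)%N => [|k IH]; rewrite ?addn0 // addnS.
    exact: subset_trans (CS _) IH.
  exists N => n Nn; have [_ _ JC] := CP n.+1.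
  exact: subset_trans (Cmono _ Nn) (subset_trans PJ JC).
exists 0%N => n _ a _; have [[_ _ CM] Csat JC] := CP n.+1.
have [t Ct Pt] : exists2 t, C n.+1 t & ~ P t.
  apply: contrapT => nt; apply: nC; exists n.+1 => t Ct.
  by apply: contrapT => Pt; apply: nt; exists t.
by apply: (Csat t) => //; rewrite mulrC; apply: CM.
Qed.

(** Nakayama's lemma at P, by elimination: a generator g is moved into L, the others are treated
    modulo L + (g), and substituting back leaves u g in L with u outside P, because x is in P. Here
    u plays the role of the unit 1 - x c. *)
Lemma nakayama_seq P x s L : is_prime P -> P x -> is_ideal L ->
  (forall g, g \in s ->
     exists t j, [/\ ~ P t, gen [set` s] j & L (t * g - x * j)]) ->
  exists2 t, ~ P t & forall g, g \in s -> L (t * g).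
Proof.
move=> [[P0 PD PM] P1 Pp] Px; elim: s L => [|g s IH] L idL Hs; first by exists 1.
have [L0 LD LM] := idL.
have [||t Pt tP] := IH (adj L g); first exact: adj_ideal.
  move=> h hs; have [|t [j [Pt]]] := Hs h; first by rewrite inE hs orbT.
  rewrite gen_cons => -[r sj] Lj; exists t, (j - r * g); split=> //.
  by exists (x * r); move: Lj; congr L; ring.
have [|t0 [j [Pt0]]] := Hs g; first by rewrite inE eqxx.
rewrite gen_cons => -[r sj] Lj.
have [q Lq] : adj L g (t * (j - r * g)).
  suff H : gen [set` s] `<=` [set z | adj L g (t * z)] by apply: H.
  have [a0 aD aM] := adj_ideal g idL.
  apply: gen_min => [|h /= /tP//]; split=> [|a b ta tb|c a ta] /=.
  - by rewrite mulr0.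
  - by rewrite mulrDr; apply: aD.
  - by rewrite mulrCA; apply: aM.
pose u := t * t0 - x * (q + t * r).
have Pu : ~ P u.
  move=> Pu; suff: P (t * t0) by case/Pp.
  rewrite -(subrK (x * (q + t * r)) (t * t0)); apply: PD => //.
  by rewrite mulrC; apply: PM.
have Lug : L (u * g).
  by have := LD _ _ (LM t _ Lj) (LM x _ Lq); congr L; rewrite /u; ring.
exists (u * t) => [|h]; first by case/Pp.
rewrite inE => /orP[/eqP->|/tP[c Lc]].
  by rewrite mulrAC mulrC; apply: LM.
by have := LD _ _ (LM u _ Lc) (LM c _ Lug); congr L; ring.
Qed.

Lemma nakayama P x J L : noether -> is_prime P -> P x -> is_ideal J ->
  is_ideal L ->
  (forall a, J a -> exists t j, [/\ ~ P t, J j & L (t * a - x * j)]) ->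
  exists2 t, ~ P t & forall a, J a -> L (t * a).
Proof.
move=> nA prP Px idJ idL HJ; have [s Js] := nA _ idJ.
have [g gs|t Pt tP] := @nakayama_seq P x s L prP Px idL.
  by rewrite -Js; apply: HJ; rewrite Js; apply: sub_gen.
exists t => // a; rewrite Js => Ja.
suff H : gen [set` s] `<=` [set z | L (t * z)] by apply: H.
have [L0 LD LM] := idL.
apply: gen_min => [|h /= /tP//]; split=> [|b c tb tc|c b tb] /=.
- by rewrite mulr0.
- by rewrite mulrDr; apply: LD.
- by rewrite mulrCA; apply: LM.
Qed.

Lemma exists_notin Q P : ~ (Q `<=` P) -> exists2 y, Q y & ~ P y.
Proof.
move=> QP; apply: contrapT => ny; apply: QP => y Qy.
by apply: contrapT => Py; apply: ny; exists y.
Qed.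

(* Krull's argument, with the symbolic powers of Q replaced by the contractions
   J n of the ideals (P0, y^n)A_Q for a single y in Q outside P0. *)
Lemma principal_ideal_theorem P0 Q P x : noether ->
  is_prime P0 -> is_prime Q -> is_prime P ->
  P0 `<` Q -> Q `<` P -> P x ->
  exists T, [/\ is_prime T, P0 `<=` T, T x & T `<` P].
Proof.
move=> nA prP0 prQ prP [P0Q QP0] [QP PQ] Px; apply: contrapT => noT.
have [idP0 P01 P0p] := prP0; have [idQ Q1 Qp] := prQ; have [idP P1 Pp] := prP.
(* If no such T exists, P is minimal over P0 + (x), as [saturated_dcc] requires. *)
have minP T : is_prime T -> adj P0 x `<=` T -> T `<=` P -> P `<=` T.
  move=> prT xT TP; apply: contrapT => PT; apply: noT; exists T; split=> //.
    by apply: subset_trans xT; apply: sub_adj.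
  by apply: xT; apply: adj_self.
have Qx : ~ Q x by move=> Qx; apply: noT; exists Q; split.
have [y Qy P0y] := exists_notin QP0.
pose J n := saturation Q (adj P0 (y ^+ n)).
have idJ n : is_ideal (J n) by exact/saturation_ideal/adj_ideal.
have JS n : J n.+1 `<=` J n.
  apply: saturation_mono; apply: adj_min; [exact: adj_ideal|exact: sub_adj|].
  rewrite exprS; have [_ _ aM] := adj_ideal (y ^+ n) idP0.
  by apply: aM; apply: adj_self.
pose C n := saturation P (adj (J n) x).
have [n|n|N /(_ N (leqnn N)) CN] :=
    @saturated_dcc P (adj P0 x) C nA prP (adj_ideal x idP0) minP.
- split; first exact/saturation_ideal/adj_ideal.
    exact: saturation_saturated.
  move=> z [r P0z]; apply: sub_saturation => //; exists r.
  by apply: sub_saturation => //; apply: sub_adj.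
- by apply: saturation_mono => z [r Jz]; exists r; apply: JS.
(* Stability of [C] at N says that, locally at P, an a in [J N] is r x modulo [J N.+1]. Then r x is
   in [J N], and x, being outside Q, cancels; so r is in [J N] and Nakayama's lemma applies. *)
have [a Ja|t Pt tP] := @nakayama P x (J N) (J N.+1) nA prP Px (idJ _) (idJ _).
  have [|s Ps [r Jr]] := CN a; first by apply: sub_saturation => //; apply: sub_adj.
  exists s, r; split=> //; last by rewrite (mulrC x).
  apply: (saturation_saturated prQ Qx).
  have -> : x * r = s * a - (s * a - r * x) by ring.
  apply: (idealB (idJ N)); last exact: JS.
  by have [_ _ ] := idJ N; apply.
have [|s Qs [r P0r]] := tP (y ^+ N).
  by apply: sub_saturation => //; apply: adj_self.
(* Since P0 is prime, either s t - r y is in P0, which puts s t in Q although s and t are outside Q,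
   or a power of y is in P0. *)
have /P0p[] : P0 ((s * t - r * y) * y ^+ N).
  by move: P0r; congr P0; rewrite exprS; ring.
  move=> /P0Q Qst; suff: Q (s * t) by case/Qp=> // /QP.
  rewrite -(subrK (r * y) (s * t)).
  by have [_ QD QM] := idQ; apply: QD => //; apply: QM.
by move=> /(prime_exp prP0).
Qed.

(** * Rerouting chains of primes; parameters of a local ring *)

Fixpoint chain n P Q : Prop :=
  if n is n'.+1 then exists2 P', chain n' P P' & P' `<` Q /\ is_prime Q
  else P = Q /\ is_prime Q.

Lemma chain_prime n P Q : chain n P Q -> is_prime P /\ is_prime Q.
Proof.
elim: n Q => [|n IH] Q; first by case=> ->.
by case=> P' /IH[prP _] [].
Qed.

Lemma chain_sub n P Q : chain n P Q -> P `<=` Q.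
Proof.
elim: n Q => [|n IH] Q; first by case=> -> _ z.
case=> P' /IH PP' [[P'Q _] _].
exact: subset_trans P'Q.
Qed.

(** Imposing x costs at most one step of the chain. If the prime T just below the top misses x, the
    principal ideal theorem replaces it by a prime through x above the next prime U; this inclusion
    is strict, as U misses x too. The induction then continues below. *)
Lemma chain_through n P Q x : noether -> chain n.+1 P Q -> Q x ->
  exists P', [/\ chain n P' Q, P `<=` P' & P' x].
Proof.
move=> nA; elim: n Q => [|n IH] Q.
  by case=> _ [<- prP] [[PQ _] prQ] Qx; exists Q; split.
case=> T cT [TQ prQ] Qx.
have [Tx|Tx] := pselect (T x).
  have [P' [cP' PP' P'x]] := IH _ cT Tx.
  by exists P'; split=> //; exists T.
have [U cU [UT prT]] := cT.
have [T' [prT' UT' T'x T'Q]] :=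
  principal_ideal_theorem nA (proj2 (chain_prime cU)) prT prQ UT TQ Qx.
have cT' : chain n.+1 P T'.
  exists U => //; split=> //; split=> // T'U; apply: Tx.
  by case: UT => UT _; apply/UT/T'U.
have [P' [cP' PP' P'x]] := IH _ cT' T'x.
by exists P'; split=> //; exists T'.
Qed.

Lemma chain_through_seq n P Q s : noether -> chain (size s + n) P Q ->
  (forall x, x \in s -> Q x) ->
  exists P', [/\ chain n P' Q, P `<=` P' & forall x, x \in s -> P' x].
Proof.
move=> nA; elim: s P => [|y s IH] P cP sQ; first by exists P; split.
have /(chain_through nA cP)[P1 [c1 P01 P1y]] : Q y by apply: sQ; rewrite inE eqxx.
have [x xs|P' [cP' P1P' sP']] := IH _ c1; first by apply: sQ; rewrite inE xs orbT.
exists P'; split=> //; first exact: subset_trans P1P'.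
by move=> x; rewrite inE => /orP[/eqP->|/sP'//]; apply: P1P'.
Qed.

(** Some z in s is outside P, as m is not contained in P. Rerouting the chain through z and
    inducting shows that I + (z) is prime and contains P. An element b = i + r z of P then has r in
    P, so P lies in I + zP, and Nakayama's lemma gives P = I. *)
Lemma parameters_prime m I P s : noether -> is_local m -> is_ideal I ->
  m `<=` gen (I `|` [set` s]) -> (forall z, z \in s -> m z) ->
  chain (size s) P m -> I `<=` P -> I = P.
Proof.
move=> nA locm; have [idm m1 mU] := locm.
move en : (size s) => n; elim: n s en I P => [|n IH] s en I P idI ms sm.
  case=> -> _ Im; apply/seteqP; split=> // z /ms.
  rewrite (size0nil en) => gz; apply: gz => // u [|] //=.
move=> cP IP; have [[idP P1 Pp] _] := chain_prime cP.
have [z zs Pz] : exists2 z, z \in s & ~ P z.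
  apply: contrapT => nz.
  have sP : m `<=` P.
    apply: subset_trans ms _; apply: gen_min => // u [/IP//|/= us].
    by apply: contrapT => Pu; apply: nz; exists u.
  case: cP => T cT [[Tm mT] _]; apply: mT.
  exact: subset_trans sP (chain_sub cT).
have [P' [cP' PP' P'z]] := chain_through nA cP (sm _ zs).
have e : adj I z = P'.
  apply: (IH (rem z s)) => //.
  - by rewrite size_rem // en.
  - exact: adj_ideal.
  - apply: subset_trans ms _; apply: gen_min; first exact: gen_ideal.
    move=> u [Iu|/= us]; apply: sub_gen; first by left; apply: sub_adj.
    have [->|uz] := eqVneq u z; first by left; apply: adj_self.
    by right; move: us; rewrite (perm_mem (perm_to_rem zs)) inE (negPf uz).
  - by move=> u /mem_rem/sm.
  - by apply: adj_min => //; [case: (chain_prime cP') => -[]|apply: subset_trans PP'].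
apply/seteqP; split=> // a Pa.
have [b Pb|t mt tP] := nakayama nA (local_prime locm) (sm _ zs) idP idI.
  have [r Ir] : adj I z b by rewrite e; apply: PP'.
  exists 1, r; split=> //; last by rewrite mul1r mulrC.
  have: P (r * z) by rewrite -(subKr b (r * z)); apply: idealB => //; apply: IP.
  by case/Pp.
have [c ct] := mU _ mt.
by rewrite -(mul1r a) -ct -mulrA; have [_ _ IM] := idI; apply/IM/tP.
Qed.

End Ideals.

(** * Completing independent elements to a regular system of parameters *)

Section RegularSystems.
Variable A : comNzRingType.
Implicit Types (m I P Q X : set A) (s : seq A).

Definition mul_gens m s : set A :=
  [set x | exists b u, [/\ m b, u \in s & x = b * u]].

(** Steinitz exchange over a local ring: a unit coefficient at some u in s lets z replace u; if
    there is none, all coefficients on s lie in m. *)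
Lemma exchange m X s z : is_local m -> gen (X `|` [set` s]) z ->
  (exists u s', perm_eq s (u :: s') /\ gen (z |` (X `|` [set` s'])) u) \/
  gen (X `|` mul_gens m s) z.
Proof.
move=> [_ _ mU]; elim: s z => [|u s IH] z.
  by move=> gz; right; apply: gen_mono gz => x [|//]; left.
rewrite set_mem_cons setUCA gen_adj => -[b gzb].
have [mb|/mU[c cb]] := pselect (m b); last first.
  left; exists u, s; split=> //.
  have [_ _ gM] := gen_ideal (z |` (X `|` [set` s])).
  have -> : u = c * (z - (z - b * u)) by rewrite subKr mulrA cb mul1r.
  apply: gM; apply: (idealB (gen_ideal _)).
    by apply: sub_gen; left.
  by apply: gen_mono gzb => x; right.
case: (IH _ gzb) => [[v [s' [ss' gv]]]|gz].
  left; exists v, (u :: s'); split.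
    rewrite -(cat1s v) -(cat1s u s') perm_sym perm_catCA /= perm_cons.
    by rewrite perm_sym.
  move: v gv {ss'}; apply: gen_min; first exact: gen_ideal.
  move=> x [->|[Xx|s'x]].
  - apply: (idealB (gen_ideal _)); first by apply: sub_gen; left.
    have [_ _ gM] := gen_ideal (z |` (X `|` [set` u :: s'])).
    by apply: gM; apply: sub_gen; right; right; rewrite /= inE eqxx.
  - by apply: sub_gen; right; left.
  - by apply: sub_gen; right; right; rewrite /= inE [_ \in _]s'x orbT.
right; rewrite -(subrK (b * u) z); have [_ gD _] := gen_ideal (X `|` mul_gens m (u :: s)).
apply: gD.
  apply: gen_mono gz => x [Xx|[c [v [mc vs ->]]]]; [by left|right].
  by exists c, v; rewrite inE vs orbT.
by apply: sub_gen; right; exists b, u; rewrite inE eqxx.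
Qed.

(* For s in m, this is linear independence in m / m^2. *)
Definition independent m s := forall s1 z s2, s = s1 ++ z :: s2 ->
  ~ gen ([set` s1] `|` [set x | exists b u, [/\ m b, m u & x = b * u]]) z.

(** Each new z is exchanged for one of the remaining generators, which keeps the total count. The
    other outcome of [exchange] would put z in the ideal of its predecessors plus m^2. *)
Lemma extend_independent m us s : is_local m -> m = gen [set` us] ->
  (forall z, z \in s -> m z) -> independent m s ->
  exists ys, [/\ (size s + size ys)%N = size us,
    forall y, y \in ys -> m y & m `<=` gen ([set` s] `|` [set` ys])].
Proof.
move=> locm mus; elim/last_ind: s => [|s z IH] sm ind.
  exists us; split=> // [y yus|]; first by rewrite mus; apply: sub_gen.
  by rewrite {1}mus; apply: gen_mono => x; right.
have [x xs|s1 x s2 e|ys [sys ysm mys]] := IH.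
- by apply: sm; rewrite mem_rcons inE xs orbT.
- by apply: (ind _ _ (rcons s2 z)); rewrite e rcons_cat.
have zm : m z by apply: sm; rewrite mem_rcons inE eqxx.
have [[u [ys' [ysu gu]]]|gz] := exchange locm (mys _ zm); last first.
  case: (ind s z [::]); first by rewrite cats1.
  apply: gen_mono gz => x [sx|[b [u [mb /ysm mu ->]]]]; [by left|right].
  by exists b, u.
exists ys'; split.
- by rewrite -sys (perm_size ysu) size_rcons /= addSnnS.
- by move=> y yys'; apply: ysm; rewrite (perm_mem ysu) inE yys' orbT.
apply: subset_trans mys _; apply: gen_min; first exact: gen_ideal.
have sub : z |` ([set` s] `|` [set` ys']) `<=` [set` rcons s z] `|` [set` ys'].
  move=> x [->|[sx|ys'x]]; [left|left|by right]; rewrite /= mem_rcons inE ?eqxx //.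
  by rewrite [_ \in _]sx orbT.
move=> x [sx|/=]; first by apply: sub_gen; apply: sub; right; left.
rewrite (perm_mem ysu) inE => /orP[/eqP->|xys']; first exact: gen_mono gu.
by apply: sub_gen; right.
Qed.

(** Once s is completed to as many generators as the chain is long, rerouting the chain through s1
    leaves exactly one step for each remaining generator, which is the count that [parameters_prime]
    asks for. *)
Lemma independent_prime m us P s s1 s2 : noether A -> is_local m ->
  m = gen [set` us] -> chain (size us) P m ->
  (forall z, z \in s -> m z) -> independent m s ->
  s = s1 ++ s2 -> is_prime (gen [set` s1]).
Proof.
move=> nA locm mus cP sm ind e.
have [ys [sys ysm mys]] := extend_independent locm mus sm ind.
have [||P' [cP' _ s1P']] := @chain_through_seq _ (size (s2 ++ ys)) P m s1 nA.
- by rewrite size_cat addnA -size_cat -e sys.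
- by move=> x xs1; apply: sm; rewrite e mem_cat xs1.
have prP' := proj1 (chain_prime cP').
rewrite (parameters_prime nA locm (gen_ideal _) _ _ cP') //.
- apply: subset_trans mys _; apply: gen_mono => x [].
    rewrite e /= mem_cat => /orP[xs1|xs2]; first by left; apply: sub_gen.
    by right; rewrite /= mem_cat xs2.
  by move=> xys; right; rewrite /= mem_cat [_ \in ys]xys orbT.
- move=> z; rewrite mem_cat => /orP[zs2|/ysm//].
  by apply: sm; rewrite e mem_cat zs2 orbT.
- by apply: gen_min => //; case: prP'.
Qed.

Lemma chain_top m n P Q : is_local m -> chain n P Q -> exists P', chain n P' m.
Proof.
move=> locm; case: n => [|n] cP.
  by exists m; split=> //; apply: local_prime.
case: cP => T cT [[TQ QT] [idQ Q1 _]]; have Qm := sub_local locm idQ Q1.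
exists P, T => //; split; last exact: local_prime.
by split=> [|mT]; [apply: subset_trans Qm|apply: QT; apply: subset_trans mT].
Qed.

Lemma chain_le m n P Q s : noether A -> is_local m -> m = gen [set` s] ->
  chain n P Q -> (n <= size s)%N.
Proof.
move=> nA locm ms /(chain_top locm)[{}P cP]; rewrite leqNgt; apply/negP => lt_sn.
have [||P' [[T cT [[Tm mT] _] PP' sP']]] :=
    (* The length left over is positive; written as a successor, it exposes a strict inclusion into
       m of a prime containing all generators of m. *)
    @chain_through_seq _ (n - size s).-1.+1 P m s nA.
- by rewrite prednK ?subn_gt0 // subnKC // ltnW.
- by rewrite ms => x xs; apply: sub_gen.
apply: mT; have P'T := chain_sub cT.
rewrite ms; apply: gen_min => [|x /sP' /P'T//].
by have [_ []] := chain_prime cT.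
Qed.

End RegularSystems.

(** * Pulling primes back along a ring morphism *)

Section Preimage.
Variables (A B : comNzRingType) (f : {rmorphism A -> B}).

Lemma preimage_ideal I : is_ideal I -> is_ideal (f @^-1` I).
Proof.
case=> I0 ID IM; split=> [|a b Ia Ib|r a Ia] /=.
- by rewrite rmorph0.
- by rewrite rmorphD; apply: ID.
- by rewrite rmorphM; apply: IM.
Qed.

Lemma preimage_prime P : is_prime P -> is_prime (f @^-1` P).
Proof.
case=> idP P1 Pp; split=> [|/=|a b /=]; first exact: preimage_ideal.
- by rewrite rmorph1.
- by rewrite rmorphM => /Pp.
Qed.

Hypothesis f_surj : forall b, exists a, f a = b.

Lemma preimage_chain n P Q :
  chain n P Q -> chain n (f @^-1` P) (f @^-1` Q).
Proof.
elim: n Q => [|n IH] Q; first by case=> -> prQ; split=> //; apply: preimage_prime.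
case=> T /IH cT [[TQ QT] prQ]; exists (f @^-1` T) => //.
split; last exact: preimage_prime.
split=> [a /TQ//|QT']; apply: QT => b Qb.
by have [a ab] := f_surj b; rewrite -ab; apply: QT'; rewrite /= ab.
Qed.

End Preimage.

Lemma chain_cat (A : comNzRingType) k n (P Q T : set A) :
  chain k P Q -> chain n Q T -> chain (n + k) P T.
Proof.
move=> cP; elim: n T => [|n IH] T; first by case=> <-.
by case=> U /IH cU ?; exists U.
Qed.

Lemma chain_enlarge (A : comNzRingType) n (P Q T : set A) :
  chain n.+1 P Q -> Q `<=` T -> is_prime T -> chain n.+1 P T.
Proof.
move=> [U cU [[UQ QU] _]] QT prT; exists U => //; split=> //.
split; first exact: subset_trans QT.
by move=> TU; apply: QU; apply: subset_trans TU.
Qed.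

(** * Primes of a directed union of regular local rings *)

Section DirectedUnion.
Variables (S : comNzRingType) (A_ : nat -> comNzRingType).
Variable g_ : forall n, {rmorphism A_ n -> S}.
Variables (mS : set S) (m_ : forall n, set (A_ n)).
Arguments m_ : clear implicits.
Hypothesis g_inj : forall n, injective (g_ n).
Hypothesis g_incr : forall n (a : A_ n), exists b, g_ n.+1 b = g_ n a.
Hypothesis g_union : forall z, exists n a, g_ n a = z.
Hypothesis local_mS : is_local mS.
Hypothesis local_m : forall n, is_local (m_ n).
Hypothesis g_local : forall n a, mS (g_ n a) <-> m_ n a.
Hypothesis noether_A : forall n, noether (A_ n).
Hypothesis regular_A : forall n, exists (us : seq (A_ n)) P,
  m_ n = gen [set` us] /\ chain (size us) P (m_ n).
Variable zs : seq S.
Hypothesis gen_zs : mS = gen [set` zs].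
Hypothesis min_zs : forall s : seq S, mS = gen [set` s] -> (size zs <= size s)%N.
Hypothesis zs_in_A : forall n z, z \in zs -> exists a, g_ n a = z.


Lemma minimal_notin s1 z s2 : zs = s1 ++ z :: s2 -> ~ gen [set` s1 ++ s2] z.
Proof.
move=> e gz; have : mS = gen [set` s1 ++ s2].
  apply/seteqP; split; rewrite gen_zs.
    apply: gen_min; first exact: gen_ideal.
    move=> x; rewrite /= e mem_cat inE orbCA -mem_cat => /orP[/eqP->//|xs].
    by apply: sub_gen.
  apply: gen_mono => x; rewrite /= e !mem_cat inE => /orP[->//|->].
  by rewrite !orbT.
by move/min_zs; rewrite e !size_cat /= addnS ltnn.
Qed.

(** The default 0 is never reached on members of [zs], by [zs_in_A]. *)
Let lift n z : A_ n := xget 0 [set a | g_ n a = z].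

Let liftK n z : z \in zs -> g_ n (lift n z) = z.
Proof.
by move=> /(zs_in_A n)[a az]; rewrite /lift; case: xgetP => [_ -> //|/(_ a)].
Qed.

Lemma lift_independent n : independent (m_ n) (map (lift n) zs).
Proof.
move=> s1 w s2 e gw.
pose g := g_ n.
have ezs : zs = map g s1 ++ g w :: map g s2.
  rewrite -map_cons -map_cat -e -map_comp -[LHS]map_id.
  by apply/eq_in_map => z zzs /=; rewrite /g liftK.
apply: (minimal_notin ezs); set O := gen _.
have idO : is_ideal O by apply: gen_ideal.
have mO : mS `<=` adj O (g w).
  rewrite gen_zs; apply: gen_min; first exact: adj_ideal.
  move=> x; rewrite /= ezs mem_cat inE orbCA -mem_cat => /orP[/eqP->|xO].
    exact: adj_self.
  by apply: sub_adj; apply: sub_gen.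
have [idm m1 mU] := local_mS; have [O0 OD OM] := idO; have [m0 mD mM] := idm.
(* T is O + m_S (g w). It contains the images of s1 and of all products b u with b, u in m_n,
   because u maps into O + (g w) and b into m_S. *)
pose T : set S := [set t | exists2 c, mS c & O (t - c * g w)].
have idT : is_ideal T.
  split; first by exists 0 => //; rewrite mul0r subr0.
  - move=> a b [c mc Oa] [d md Ob]; exists (c + d); first exact: mD.
    by have := OD _ _ Oa Ob; congr O; ring.
  - move=> r a [c mc Oa]; exists (r * c); first exact: mM.
    by have := OM r _ Oa; congr O; ring.
have [c mc Oc] : T (g w).
  apply: (gen_min (preimage_ideal g idT) _ gw) => x [/= xs1|[b [u [mb mu ->]]]].
    exists 0 => //; rewrite mul0r subr0; apply: sub_gen.
    by rewrite /= mem_cat map_f.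
  have [r Or] := mO _ (proj2 (g_local u) mu).
  exists (g b * r).
    by rewrite mulrC; apply/mM/g_local.
  by rewrite rmorphM -mulrA -mulrBr; apply: OM.
have [|b bc] := mU (1 - c).
  by move=> m1c; apply: m1; rewrite -(subrK c 1); apply: mD.
by rewrite -(mul1r (g w)) -bc -mulrA mulrBl mul1r; apply: OM.
Qed.

Lemma lift_mem n z : z \in map (lift n) zs -> m_ n z.
Proof.
move=> /mapP[w wzs ->]; apply/g_local; rewrite liftK // gen_zs.
exact: sub_gen.
Qed.

(** The images [D n] of the primes generated by s1 in [A_ n] increase to the ideal of s1 in S. A
    product in that ideal is tested at a stage N containing both factors, where injectivity of [g_]
    pulls it back to a prime. *)
Lemma prefix_gen_prime s1 s2 : zs = s1 ++ s2 -> is_prime (gen [set` s1]).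
Proof.
move=> e; pose s n := map (lift n) s1.
have s1zs z : z \in s1 -> z \in zs by rewrite e mem_cat => ->.
have prs n : is_prime (gen [set` s n]).
  have [us [P [mus cP]]] := regular_A n.
  have es : map (lift n) zs = s n ++ map (lift n) s2 by rewrite e map_cat.
  exact: independent_prime (@noether_A n) (@local_m n) mus cP (@lift_mem n)
    (@lift_independent n) es.
pose D n := g_ n @` gen [set` s n].
have g_mono n k (a : A_ n) : (n <= k)%N -> exists b, g_ k b = g_ n a.
  elim: k => [|k IH]; first by rewrite leqn0 => /eqP n0; subst n; exists a.
  rewrite leq_eqVlt => /orP[/eqP nk|/IH[b <-]]; last exact: g_incr.
  by subst n; exists a.
have idD n : [/\ D n 0, forall a b, D n a -> D n b -> D n (a + b)
    & forall r a, D n a -> D n (g_ n r * a)].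
  have [g0 gD gM] := gen_ideal [set` s n]; split.
  - by exists 0 => //; rewrite rmorph0.
  - by move=> _ _ [a Ga <-] [b Gb <-]; exists (a + b); rewrite ?rmorphD //; apply: gD.
  - by move=> r _ [a Ga <-]; exists (r * a); rewrite ?rmorphM //; apply: gM.
have DS n : D n `<=` D n.+1.
  have [D0 DD DM] := idD n.+1.
  suff : gen [set` s n] `<=` [set a | D n.+1 (g_ n a)] by move=> H _ [a /H ? <-].
  apply: gen_min; first split=> [|a b Da Db|r a Da] /=.
  - by rewrite rmorph0.
  - by rewrite rmorphD; apply: DD.
  - by rewrite rmorphM; have [r' <-] := g_incr r; apply: DM.
  move=> _ /mapP[z zs1 ->] /=; exists (lift n.+1 z); last by rewrite !liftK ?s1zs.
  by apply: sub_gen; apply: map_f.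
have Dmono n k : (n <= k)%N -> D n `<=` D k.
  by move/subnKC<-; elim: (k - n)%N => [|j IH] x Dx; rewrite ?addn0 // addnS; apply/DS/IH.
have Dgen n : D n `<=` gen [set` s1].
  suff : gen [set` s n] `<=` g_ n @^-1` gen [set` s1] by move=> H _ [a /H ? <-].
  apply: gen_min; first exact/preimage_ideal/gen_ideal.
  move=> _ /mapP[z zs1 ->] /=; rewrite liftK ?s1zs //; exact: sub_gen.
have genD : gen [set` s1] `<=` [set x | exists n, D n x].
  apply: gen_min; last first.
    move=> z zs1; exists 0%N, (lift 0 z); last by rewrite liftK ?s1zs.
    by apply: sub_gen; apply: map_f.
  split=> [|a b [n Da] [k Db]|r a [n Da]].
  - by exists 0%N; have [] := idD 0%N.
  - exists (maxn n k); have [_ DD _] := idD (maxn n k).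
    by apply: DD; [apply: Dmono Da|apply: Dmono Db]; rewrite leq_max leqnn ?orbT.
  - have [k [r' <-]] := g_union r; exists (maxn n k).
    have [_ _ DM] := idD (maxn n k).
    have [|r'' <-] := g_mono k (maxn n k) r'; first by rewrite leq_max leqnn orbT.
    by apply: DM; apply: Dmono Da; rewrite leq_max leqnn.
split; first exact: gen_ideal.
  have [_ m1 _] := local_mS; move=> g1; apply: m1; rewrite gen_zs.
  by apply: gen_mono g1 => x /= /s1zs.
move=> a b /genD[n Dab].
have [k [a0 a0E]] := g_union a; have [l [b0 b0E]] := g_union b.
pose N := maxn n (maxn k l).
have [nN kN lN] : [/\ n <= N, k <= N & l <= N]%N.
  by rewrite !leq_max !leqnn !orbT.
have [a1 a1E] := g_mono _ _ a0 kN; have [b1 b1E] := g_mono _ _ b0 lN.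
have [c sc] := Dmono _ _ nN _ Dab.
rewrite -a0E -b0E -a1E -b1E -rmorphM => /g_inj c_ab.
have [_ _ sp] := prs N.
have /sp[sa|sb] : gen [set` s N] (a1 * b1) by rewrite -c_ab.
  by left; apply: (Dgen N); exists a1.
by right; apply: (Dgen N); exists b1.
Qed.

(** The prefixes of [zs] give the chain, starting from the zero ideal of the empty prefix; equality
    of two consecutive ideals would make a generator redundant. *)
Lemma prefix_chain : exists P, chain (size zs) P mS.
Proof.
have e k : zs = take k zs ++ drop k zs by rewrite cat_take_drop.
exists (gen [set` take 0 zs]); rewrite gen_zs -[in X in chain _ _ X](take_size zs).
have: (size zs <= size zs)%N by [].
(* The length and the prefix become k, while the upper bound [size zs] stays fixed. *)
elim: {1 3 4}(size zs) => [|k IH] ltk.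
  by split=> //; apply: prefix_gen_prime (e 0%N).
exists (gen [set` take k zs]); first exact/IH/ltnW.
split; last exact: prefix_gen_prime (e k.+1).
split.
  apply: gen_mono => x; rewrite /= (take_nth 0 ltk) mem_rcons inE => ->.
  by rewrite orbT.
move=> sub; apply: (@minimal_notin (take k zs) (nth 0 zs k) (drop k.+1 zs)).
  by rewrite -drop_nth // cat_take_drop.
have : gen [set` take k zs] (nth 0 zs k).
  apply: sub; apply: sub_gen.
  by rewrite /= (take_nth 0 ltk) mem_rcons inE eqxx.
by apply: gen_mono => x xk; rewrite /= mem_cat [_ \in take _ _]xk.
Qed.

End DirectedUnion.

(** * Translation between ideals as sets and the library ideals of the statement *)

Section LibraryIdeals.
Variable A : comNzRingType.
Implicit Types (I P Q m : set A).

Lemma idealr_is_ideal (J : idealr A) : is_ideal [set` J].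
Proof.
split=> [|a b|r a] /=; first exact: rpred0.
  exact: rpredD.
exact: idealMr.
Qed.

Lemma idealr_proper (J : idealr A) : ~ [set` J] 1.
Proof. by rewrite /= idealr1. Qed.

Lemma prime_idealr_is_prime (p : prime_idealr A) : is_prime [set` p].
Proof.
split; [exact: idealr_is_ideal|exact: idealr_proper|].
by move=> a b /=; rewrite prime_idealrM => /orP.
Qed.

Lemma ideal_idealr I : is_ideal I -> ~ I 1 -> exists J : idealr A, [set` J] = I.
Proof.
move=> idI I1; have [I0 ID IM] := idI; pose p : {pred A} := fun a => `[<I a>].
have cl : idealr_closed p.
  split=> [||r a b].
  - exact/asboolP.
  - by apply/negP => /asboolP.
  - by move=> /asboolP Ia /asboolP Ib; apply/asboolP/ID => //; apply: IM.
pose J : idealr A := HB.pack p (isIdealr.Build A p cl).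
by exists J; apply/seteqP; split=> a /asboolP.
Qed.

Lemma prime_prime_idealr P : is_prime P -> exists J : prime_idealr A, [set` J] = P.
Proof.
move=> [idP P1 Pp]; have [J JP] := ideal_idealr idP P1.
have pcl : prime_idealr_closed J.
  move=> a b Jab; have /Pp : P (a * b) by rewrite -JP.
  by rewrite -JP => -[aJ|bJ]; apply/orP; [left|right].
pose J' : prime_idealr A :=
  HB.pack (J : A -> bool) J (isPrimeIdealrClosed.Build A J pcl).
by exists J'.
Qed.

Lemma gen_range n (g : 'I_n -> A) :
  gen (range g) = [set a | exists c : 'I_n -> A, a = \sum_i c i * g i].
Proof.
apply/seteqP; split.
  apply: gen_min; first split.
  - by exists (fun=> 0); rewrite big1 // => i _; rewrite mul0r.
  - move=> _ _ [c ->] [c' ->]; exists (fun i => c i + c' i).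
    by rewrite -big_split; apply: eq_bigr => i _; rewrite mulrDl.
  - move=> r _ [c ->]; exists (fun i => r * c i).
    by rewrite mulr_sumr; apply: eq_bigr => i _; rewrite mulrA.
  - move=> _ [i _ <-]; exists (fun j => (j == i)%:R).
    rewrite (bigD1 i) //= eqxx mul1r big1 ?addr0 // => j /negPf->.
    by rewrite mul0r.
move=> _ [c ->]; have [g0 gD gM] := gen_ideal (range g).
by apply: big_ind => // i _; apply: gM; apply: sub_gen; exists i.
Qed.

Lemma generated_byP (I : {pred A}) n :
  generated_by I n <-> exists2 s : seq A, size s = n & [set` I] = gen [set` s].
Proof.
split=> [[g Ig]|[s <- Is]].
  exists (codom g); first by rewrite size_codom card_ord.
  have -> : [set` codom g] = range g.
    apply/seteqP; split=> a /=; first by move=> /codomP[i ->]; exists i.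
    by move=> [i _ <-]; apply: codom_f.
  by rewrite gen_range; apply/seteqP; split=> a /Ig.
exists (fun i : 'I_(size s) => s`_i) => a.
have -> : (a \in I) = [set` I] a :> Prop by [].
rewrite Is; have -> : [set` s] = range (fun i : 'I_(size s) => s`_i).
  apply/seteqP; split=> b /=; last by move=> [i _ <-]; apply: mem_nth.
  move=> bs; have ltb : (index b s < size s)%N by rewrite index_mem.
  by exists (Ordinal ltb) => //=; rewrite nth_index.
by rewrite gen_range.
Qed.

Lemma noetherian_noether : noetherian A -> noether A.
Proof.
move=> nA I idI; have [I1|/(ideal_idealr idI)[J <-]] := pselect (I 1).
  exists [:: 1]; have [_ _ IM] := idI; apply/seteqP; split=> a Ia.
    rewrite -(mulr1 a); have [_ _] := gen_ideal [set` [:: 1 : A]]; apply.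
    by apply: sub_gen; rewrite /= inE.
  by rewrite -(mulr1 a); apply: IM.
by have [n /generated_byP[s _ Js]] := nA J; exists s.
Qed.

(** A non-invertible a lies in a proper ideal that is maximal among those containing a. Such an
    ideal is a maximal ideal, hence is m. *)
Lemma local_with_is_local (m : idealr A) :
  noether A -> local_with m -> is_local [set` m].
Proof.
move=> nA [_ m_uniq]; split; [exact: idealr_is_ideal|exact: idealr_proper|].
move=> a ma; apply: contrapT => na.
pose Aa : set A := adj [set 0] a.
have id0 : is_ideal [set 0 : A].
  by split=> [//|b c -> ->|r b ->]; rewrite ?addr0 ?mulr0.
have [||I [idI I1 aI] maxI] :=
    @noether_max A [set I | [/\ is_ideal I, ~ I 1 & Aa `<=` I]] nA.
- by move=> I [].
- exists Aa; split=> //; first exact: adj_ideal.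
  by move=> [r /= /eqP]; rewrite subr_eq0 => /eqP r1; apply: na; exists r.
have [J JI] := ideal_idealr idI I1.
have: a \in J.
  by have : I a; [apply/aI/adj_self|rewrite -JI].
rewrite (m_uniq J) // => J' JJ' b; apply/idP/idP; last exact: JJ'.
have: [set` J'] `<=` [set` J]; last by apply.
rewrite JI; apply: maxI; last by rewrite -JI.
split; [exact: idealr_is_ideal|exact: idealr_proper|].
by apply: subset_trans aI _; rewrite -JI.
Qed.

Lemma is_local_local_with m : is_local m ->
  exists2 J : idealr A, local_with J & [set` J] = m.
Proof.
move=> locm; have [idm m1 _] := locm.
have [J Jm] := ideal_idealr idm m1; exists J => //.
have subJ (I : idealr A) : {subset I <= J}.
  move=> a Ia; have : m a; last by rewrite -Jm.
  exact: (sub_local locm (idealr_is_ideal I) (@idealr_proper I)).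
split=> [I JI a|I maxI]; first by apply/idP/idP; [apply: subJ|apply: JI].
by move=> a; rewrite (maxI J).
Qed.

Lemma prime_chain_chain n (P : 'I_n.+1 -> prime_idealr A) :
  prime_chain P -> chain n [set` P ord0] [set` P ord_max].
Proof.
move=> cP; have -> : ord_max = inord n :> 'I_n.+1.
  by apply: val_inj; rewrite /= inordK.
suff H k : (k <= n)%N -> chain k [set` P ord0] [set` P (inord k)] by apply: H.
elim: k => [|k IH] ltkn.
  have -> : inord 0 = ord0 :> 'I_n.+1 by apply: val_inj; rewrite /= inordK.
  by split=> //; apply: prime_idealr_is_prime.
exists [set` P (inord k)]; first exact/IH/ltnW.
split; last exact: prime_idealr_is_prime.
have [|PP nPP] := cP (inord k) (inord k.+1); last by split.
by rewrite !inordK // ltnS ltnW.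
Qed.

Lemma chain_prime_chain n P Q : chain n P Q -> krull_dim_ge A n.
Proof.
(* Indexing by [nat] keeps one type for the function through the induction; values beyond n are
   filler. *)
suff H : chain n P Q -> exists2 f : nat -> prime_idealr A, [set` f n] = Q &
    forall i j, (i < j <= n)%N -> [set` f i] `<` [set` f j].
  move=> /H[f _ fP]; exists (fun i : 'I_n.+1 => f i) => i j ij.
  by have [|fij nfji] := fP i j; [rewrite ij -ltnS ltn_ord|split].
elim: n Q => [|n IH] Q.
  case=> _ /prime_prime_idealr[q qQ]; exists (fun=> q) => // i j.
  by move=> /andP[ij]; rewrite leqn0 => /eqP j0; rewrite j0 in ij.
case=> T /IH[f fT fP] [[TQ QT] /prime_prime_idealr[q qQ]].
exists (fun i => if (i <= n)%N then f i else q); first by rewrite ltnn.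
move=> i j /andP[ij]; rewrite leq_eqVlt ltnS => /orP[/eqP jn|jn].
  move: ij; rewrite jn ltnS ltnn => lein; rewrite lein qQ.
  move: lein; rewrite leq_eqVlt => /orP[/eqP->|ltin]; first by rewrite fT; split.
  have [|fiT Tfi] := fP i n; first by rewrite ltin /=.
  rewrite fT in fiT Tfi; split; first exact: subset_trans TQ.
  by move=> Qfi; apply: QT; apply: subset_trans fiT.
by rewrite jn (leq_trans (ltnW ij) jn); apply: fP; rewrite ij.
Qed.

Lemma krull_dim_geP n : krull_dim_ge A n <-> exists P Q, chain n P Q.
Proof.
split=> [[P /prime_chain_chain cP]|[P [Q /chain_prime_chain//]]].
by do 2!eexists; exact: cP.
Qed.

Lemma krull_dim_ge_leq k n : (k <= n)%N -> krull_dim_ge A n -> krull_dim_ge A k.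
Proof.
move=> /subnKC<-; rewrite addnC; elim: (n - k)%N => [//|j IH].
by move=> /krull_dim_geP[P [Q [T cT _]]]; apply/IH/krull_dim_geP; exists P, T.
Qed.

Lemma krull_dim_ge_le d n : krull_dim A d -> krull_dim_ge A n -> (n <= d)%N.
Proof.
move=> [_ nd] nn; rewrite leqNgt; apply/negP => ltdn; apply: nd.
exact: krull_dim_ge_leq nn.
Qed.

Lemma regular_local_parameters d : regular_local A -> krull_dim A d ->
  [/\ noether A & exists2 m : idealr A, local_with m &
    is_local [set` m] /\ exists us P,
      [/\ size us = d, [set` m] = gen [set` us] & chain d P [set` m]]].
Proof.
move=> [/noetherian_noether nA [m locm [d' [ged' ned']]]].
move=> /generated_byP[us us_d' mus] dimd.
have e : d' = d.
  apply/eqP; rewrite eqn_leq (krull_dim_ge_le dimd) //.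
  by apply: krull_dim_ge_le (proj1 dimd); split.
split=> //; exists m => //; have locm' := local_with_is_local nA locm.
split=> //; have /krull_dim_geP[P [Q cP]] := proj1 dimd.
by have [P' cP'] := chain_top locm' cP; exists us, P'; rewrite us_d'.
Qed.

End LibraryIdeals.

Lemma krull_dim_ge_surj (A B : comNzRingType) (f : {rmorphism A -> B}) n :
  (forall b, exists a, f a = b) -> krull_dim_ge B n -> krull_dim_ge A n.
Proof.
move=> f_surj /krull_dim_geP[P [Q /(preimage_chain f_surj) cP]].
by apply/krull_dim_geP; do 2!eexists; exact: cP.
Qed.

(** * Generators of the maximal ideal modulo a regular prime *)

Section RegularPrime.
Local Open Scope quotient_scope.
Variables (A : comNzRingType) (p : prime_idealr A).
Local Notation quot := {ideal_quot p}.

Let f : {rmorphism A -> quot} := \pi_{ideal_quot p}.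

(** The ys lift d' = dim A/p generators of the maximal ideal of A/p. A chain of length 2 ending at
    p, placed below the preimage of a chain of length d', gives d' + 2 <= d. *)
Lemma regular_prime_generators (m : idealr A) d : noether A -> is_local [set` m] ->
  krull_dim A d -> regular_prime p -> height_ge p 2 ->
  exists ys, [/\ ((size ys).+2 <= d)%N, {subset ys <= m} &
    [set` m] `<=` gen ([set` p] `|` [set` ys])].
Proof.
move=> nA locm dimd regp [P /prime_chain_chain cP Pp].
have f_surj (b : quot) : exists a, f a = b by exists (repr b); apply: reprK.
have [_ [M0 _ [d' dimd' _]]] := regp.
have [nB [M _ [locM [us [P' [us_d' Mus cP']]]]]] := regular_local_parameters regp dimd'.
pose ys := map repr us.
have idm : is_ideal [set` m] by case: locm.
have f_eq0 a b : f a = f b -> a - b \in p.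
  by rewrite Quotient.idealrBE => ->.
have pm : [set` p] `<=` [set` m].
  by apply: sub_local => //; [exact: idealr_is_ideal|exact: idealr_proper].
have prM : is_prime (f @^-1` [set` M]) by exact/preimage_prime/local_prime.
have Mm : f @^-1` [set` M] `<=` [set` m] by apply: sub_local => //; case: prM.
have mM : [set` m] `<=` f @^-1` [set` M].
  move=> a ma; have [_ _ MU] := locM; apply: contrapT => /MU[b].
  have [b' <-] := f_surj b; rewrite -rmorphM -(rmorph1 f) => /f_eq0 /pm ba1.
  have [_ m1 _] := locm; apply: m1.
  have -> : 1 = b' * a - (b' * a - 1) by rewrite subKr.
  by apply: idealB => //; have [_ _] := idm; apply.
pose G := gen ([set` p] `|` [set` ys]).
have [G0 GD GM] : is_ideal G by apply: gen_ideal.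
exists ys; split.
(* The preimage of P' contains p, so the height chain can end there instead of at p and the two
   chains fit together. *)
- have c2 : chain 2 [set` P ord0] (f @^-1` P').
    apply: (chain_enlarge cP) (preimage_prime f (proj1 (chain_prime cP'))).
    move=> a; rewrite /= Pp => pa; suff -> : f a = 0.
      by have [[[]]] := chain_prime cP'.
    by rewrite -(rmorph0 f); apply/eqP; rewrite -Quotient.idealrBE subr0.
  rewrite size_map us_d' -addn2; apply: (krull_dim_ge_le dimd).
  by apply/krull_dim_geP; do 2!eexists; apply: chain_cat c2 (preimage_chain f_surj cP').
- move=> _ /mapP[b bus ->]; apply: Mm; rewrite /= /f /= reprK.
  have : [set` M] b; last by [].
  by rewrite Mus; apply: sub_gen.
move=> a /mM; rewrite Mus => fa.
have [a' Ga' /f_eq0 a'a] : (f @` G) (f a).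
  apply: fa => [|b bus]; last first.
    exists (repr b); last by rewrite /f /= reprK.
    by apply: sub_gen; right; apply: map_f.
  split=> [|_ _ [b Gb <-] [c Gc <-]|r _ [b Gb <-]].
  - by exists 0; rewrite ?rmorph0.
  - by exists (b + c); rewrite ?rmorphD //; apply: GD.
  - by have [r' <-] := f_surj r; exists (r' * b); rewrite ?rmorphM //; apply: GM.
rewrite -(subKr a' a); apply: (idealB (gen_ideal _)) => //.
by apply: sub_gen; left.
Qed.

End RegularPrime.

(** A choice-free name for the maximal ideal, so that different [idealr] witnesses at the same stage
    agree. *)
Definition nonunits (A : comNzRingType) : set A :=
  [set a | ~ exists b, b * a = 1].
Arguments nonunits : clear implicits.

Lemma local_nonunits (A : comNzRingType) (m : set A) :
  is_local m -> m = nonunits A.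
Proof.
move=> [[_ _ mM] m1 mU]; apply/seteqP; split=> [a ma [b ba]|a na].
  by apply: m1; rewrite -ba; apply: mM.
by apply: contrapT => /mU.
Qed.

(** * Subrings of K and local monoidal transforms *)

Section Subrings.
Variable K : fieldType.

Definition incl (R S : subringClosed K) (h : {subset R <= S}) (a : subring R) :
  subring S := Sub (\val a) (h _ (valP a)).

Section Inclusion.
Variables (R S : subringClosed K) (h : {subset R <= S}).

Lemma val_incl a : \val (incl h a) = \val a.
Proof. exact: SubK. Qed.

Lemma incl_is_zmod_morphism : zmod_morphism (incl h).
Proof. by move=> a b; apply: val_inj; rewrite rmorphB !val_incl rmorphB. Qed.

Lemma incl_is_monoid_morphism : monoid_morphism (incl h).
Proof.
split; first by apply: val_inj; rewrite val_incl !rmorph1.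
by move=> a b; apply: val_inj; rewrite rmorphM !val_incl rmorphM.
Qed.

HB.instance Definition _ :=
  GRing.isZmodMorphism.Build _ _ (incl h) incl_is_zmod_morphism.
HB.instance Definition _ :=
  GRing.isMonoidMorphism.Build _ _ (incl h) incl_is_monoid_morphism.

Lemma incl_inj : injective (incl h).
Proof. by move=> a b /(congr1 \val); rewrite !val_incl => /val_inj. Qed.

Lemma incl_onto (b : subring S) : \val b \in R -> exists a, incl h a = b.
Proof.
by move=> bR; exists (Sub (\val b) bR); apply: val_inj; rewrite val_incl SubK.
Qed.

End Inclusion.

(** Extensionally equal subrings have different carrier types; the inclusion between them is
    onto. *)
Lemma krull_dim_ge_eq (R R' : subringClosed K) n :
  R =i R' -> krull_dim_ge (subring R) n -> krull_dim_ge (subring R') n.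
Proof.
move=> RR'; have h : {subset R' <= R} by move=> z; rewrite RR'.
apply: (@krull_dim_ge_surj _ _ (incl h)) => b.
by apply: incl_onto; rewrite -RR'; apply: valP.
Qed.

Lemma local_monoidal_transform_sub (R R1 : subringClosed K) :
  local_monoidal_transform R R1 -> {subset R <= R1}.
Proof.
move=> [_ [m [p [x [m1 [_ _ _ _ R1E]]]]]] z zR; apply/R1E.
have zB : z \in blowup_algebra p x by apply/asboolP => T RT _; apply: RT.
exists (Sub z zB), 1; rewrite idealr1; split=> //.
by rewrite SubK rmorph1 divr1.
Qed.

(* The ideal p of R extends to the principal ideal (x) of R1, and R/p has
   dimension at most d - 2. *)
Lemma local_monoidal_transform_generators (R R1 S : subringClosed K) d
    (RS : {subset R <= S}) :
  local_monoidal_transform R R1 -> {subset R1 <= S} -> krull_dim (subring R) d ->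
  exists s : seq (subring R), [/\ (size s < d)%N,
    forall y, y \in s -> nonunits (subring R) y &
    forall a, nonunits (subring R) a ->
      gen [set` map (incl RS) s] (incl RS a)].
Proof.
move=> [regR [m [p [x [m1 [locm [regp htp] [px xp2] _ R1E]]]]]] R1S dimR.
have [nR _] := regular_local_parameters regR dimR.
have locm' := local_with_is_local nR locm.
have [ys [ysd ysm mys]] := regular_prime_generators nR locm' dimR regp htp.
have idm := idealr_is_ideal m.
have pm : [set` p] `<=` [set` m].
  by apply: sub_local => //; [exact: idealr_is_ideal|exact: idealr_proper].
exists (x :: ys); rewrite -(local_nonunits locm'); split=> //.
  by move=> y; rewrite inE => /orP[/eqP->|/ysm//]; apply: pm.
move=> a /mys; set G := gen [set` _]; move: a.
have [G0 GD GM] : is_ideal G by apply: gen_ideal.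
suff : gen ([set` p] `|` [set` ys]) `<=` (incl RS) @^-1` G by apply.
apply: gen_min; first exact/preimage_ideal/gen_ideal.
move=> y [/= py|/= yys]; last first.
  by apply: sub_gen; rewrite /= inE map_f ?orbT.
(* Zero is an empty sum and so lies in p^2, which x avoids. *)
have x0 : \val x != 0.
  apply/eqP => x0; apply: xp2; exists 0%N, (fun=> 0), (fun=> 0).
  by split=> [[]|[]|] //; rewrite big_ord0; apply: val_inj; rewrite rmorph0.
have yxB : \val y / \val x \in blowup_algebra p x.
  by apply/asboolP => T _; apply; exists y.
have yxS : \val y / \val x \in S.
  apply/R1S/R1E; exists (Sub (\val y / \val x) yxB), 1; rewrite idealr1; split=> //.
  by rewrite SubK rmorph1 divr1.
have -> : incl RS y = Sub (\val y / \val x) yxS * incl RS x.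
  by apply: val_inj; rewrite rmorphM /= divfK.
by apply: GM; apply: sub_gen; rewrite /= inE eqxx.
Qed.

End Subrings.

Theorem corollary3p6 (K : fieldType) (R S : subringClosed K) (d : nat)
    (regR : regular_local (subring R)) (dimR : krull_dim (subring R) d)
    (shannonS : monoidal_shannon_extension R S)
    (noethS : noetherian (subring S)) :
  regular_local (subring S) /\
  exists2 e : nat, krull_dim (subring S) e & (e <= d - 1)%N.
Proof.
have [R_ [R0 trans m_incr [d0 _ dimR_]] SE] := shannonS.
(* The sequence brings its own common dimension, identified with d through its first ring. *)
have dd0 : d0 = d.
  apply/eqP; rewrite eqn_leq (krull_dim_ge_le dimR) ?(krull_dim_ge_le (dimR_ 0%N)) //.
    by apply: (krull_dim_ge_eq _ (proj1 dimR)) => z; rewrite R0.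
  exact: krull_dim_ge_eq R0 (proj1 (dimR_ 0%N)).
subst d0; pose A_ n := subring (R_ n).
have paramsA n := regular_local_parameters (proj1 (trans n)) (dimR_ n).
have nA n : noether (A_ n) by have [] := paramsA n.
have locA n : is_local (nonunits (A_ n)).
  by have [_ [m _ [locm _]]] := paramsA n; rewrite -(local_nonunits locm).
have RS n : {subset R_ n <= S} by move=> z zR; apply/SE; exists n.
have RR n k : (n <= k)%N -> {subset R_ n <= R_ k}.
  move=> /subnKC<-; elim: (k - n)%N => [|j IH] z zR; rewrite ?addn0 // addnS.
  exact/(local_monoidal_transform_sub (trans _))/IH.
pose g n : {rmorphism A_ n -> subring S} := incl (RS n).
have g_inj n : injective (g n) by apply: incl_inj.
have g_union (z : subring S) : exists n a, g n a = z.
  by have /SE[n zn] := valP z; exists n; apply: incl_onto.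
have g_mono n k a : (n <= k)%N -> exists b, g k b = g n a.
  move=> lenk; exists (incl (RR _ _ lenk) a); apply: val_inj.
  by rewrite !val_incl.
have m_mono n k a b : (n <= k)%N -> g k b = g n a ->
    nonunits (A_ n) a -> nonunits (A_ k) b.
  elim: k b => [|N IH] b.
    by rewrite leqn0 => /eqP n0; subst n => /g_inj->.
  rewrite leq_eqVlt => /orP[/eqP nN|]; first by subst n => /g_inj->.
  rewrite ltnS => lenN gba na; have [c gca] := g_mono n N a lenN.
  have [_ [m locm [locm1 _]]] := paramsA N.
  have [_ [m' locm' [locm1' _]]] := paramsA N.+1.
  have mc : c \in m.
    have : nonunits (A_ N) c by apply: IH.
    by rewrite -(local_nonunits locm1).
  have [b' mb' b'c] := m_incr N _ _ locm locm' c mc.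
  have <- : b' = b.
    apply: (g_inj N.+1); rewrite gba -gca; apply: val_inj.
    by rewrite !val_incl.
  by rewrite -(local_nonunits locm1').
(* An inverse in S of a nonunit of [R_ n] would already lie in some later ring, where [m_mono]
   forbids it. *)
have g_local n a : nonunits (subring S) (g n a) <-> nonunits (A_ n) a.
  split=> na [b ba]; first by apply: na; exists (g n b); rewrite -rmorphM ba rmorph1.
  have [k [b' b'b]] := g_union b.
  have [a1 ga1] := g_mono n (maxn n k) a (leq_maxl _ _).
  have [b1 gb1] := g_mono k (maxn n k) b' (leq_maxr _ _).
  apply: (m_mono _ _ _ _ (leq_maxl _ _) ga1 na); exists b1.
  by apply: g_inj; rewrite rmorphM ga1 gb1 b'b ba rmorph1.
have locS : is_local (nonunits (subring S)).
  split; [split|by apply; exists 1; rewrite mul1r|by move=> a /contrapT].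
  - by move=> [b /eqP]; rewrite mulr0 eq_sym oner_eq0.
  - move=> a b; have [n [a0 <-]] := g_union a; have [k [b0 <-]] := g_union b.
    have [a1 <-] := g_mono n (maxn n k) a0 (leq_maxl _ _).
    have [b1 <-] := g_mono k (maxn n k) b0 (leq_maxr _ _).
    rewrite -rmorphD !g_local; have [[_ mD _] _ _] := locA (maxn n k).
    exact: mD.
  - by move=> r a na [c cra]; apply: na; exists (c * r); rewrite -mulrA.
have nS := noetherian_noether noethS.
have in_range (s : seq (subring S)) :
    exists N, forall n, (N <= n)%N -> forall z, z \in s -> exists a, g n a = z.
  apply: (@seq_in_directed_union _ (fun n => [set z | exists a, g n a = z])).
    by move=> n _ [a <-]; apply: g_mono.
  by move=> z _; apply: g_union.
have [s [ltsd ms]] : exists s : seq (subring S), (size s < d)%N /\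
    nonunits (subring S) = gen [set` s].
  have [ws mws] := nS _ (let: And3 h _ _ := locS in h).
  (* Finitely many generators of m_S come from one [R_ N], and by [g_local] from its maximal ideal;
     the d - 1 elements or fewer generating the extension of that ideal then generate m_S. *)
  have [N /(_ N (leqnn N)) wsN] := in_range ws.
  have [s [ltsd sm ms]] := local_monoidal_transform_generators (RS N) (trans N)
    (RS N.+1) (dimR_ N).
  exists (map (g N) s); rewrite size_map; split=> //.
  apply/seteqP; split.
    rewrite mws; apply: gen_min; first exact: gen_ideal.
    move=> w /= wws; have [a aw] := wsN _ wws; rewrite -aw; apply: ms.
    by apply/g_local; rewrite aw mws; apply: sub_gen.
  apply: gen_min; first by case: locS.
  by move=> _ /mapP[a /sm na ->]; apply/g_local.
have [|e /asboolP[zs zse mzs] min_e] := @ex_minnP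
    (fun e => `[< exists2 s : seq (subring S), size s = e
                  & nonunits (subring S) = gen [set` s] >]).
  by exists (size s); apply/asboolP; exists s.
have min_zs (s' : seq (subring S)) :
    nonunits (subring S) = gen [set` s'] -> (size zs <= size s')%N.
  by move=> ms'; rewrite zse; apply: min_e; apply/asboolP; exists s'.
have [N zsN] := in_range zs.
have [P cP] : exists P, chain (size zs) P (nonunits (subring S)).
  (* Starting the sequence at N puts the minimal generators in every ring of it. *)
  apply: (@prefix_chain _ (fun n => A_ (N + n)%N) (fun n => g (N + n)%N) _
    (fun n => nonunits (A_ (N + n)%N))) => //.
  - by move=> n; apply: g_inj.
  - by move=> n a; apply: g_mono; rewrite leq_add2l.
  - move=> z; have [k [a <-]] := g_union z; exists k; apply: g_mono.
    exact: leq_addl.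
  - by move=> n; apply: g_local.
  - move=> n; have [_ [m _ [locm [us [P [<- mus cP]]]]]] := paramsA (N + n)%N.
    by exists us, P; rewrite -(local_nonunits locm).
  - by move=> n z; apply: zsN; apply: leq_addr.
have dimS : krull_dim (subring S) (size zs).
  split; first exact: chain_prime_chain cP.
  move=> /krull_dim_geP[P' [Q' /(chain_le nS locS mzs)]].
  by rewrite ltnn.
split; last first.
  have ltzd := leq_ltn_trans (min_zs _ ms) ltsd.
  by exists (size zs) => //; rewrite subn1 -ltnS prednK // (leq_trans _ ltzd).
split=> //; have [J locJ Jm] := is_local_local_with locS.
by exists J => //; exists (size zs) => //; apply/generated_byP; exists zs; rewrite ?Jm.
Qed.
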